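(* Let $q$ be a power of an odd prime with $q\equiv 1\pmod 4$, let $V$ be a $2$-dimensional vector space over $\mathbb{F}_q$ with a non-degenerate alternating bilinear form $f$, and let $G$ be a solvable subgroup of $\mathrm{Sp}(V)\cong\mathrm{Sp}(2,q)$. Then $G$ does not act transitively on any complete symplectic spread of $V$ unless $q=5$. Moreover, when $q=5$, the subgroup $\mathrm{SL}(2,3)$ (of order $24$) of $\mathrm{Sp}(2,5)$ acts transitively on a complete symplectic spread of the $2$-dimensional space over $\mathbb{F}_5$.
   Context: A subspace $W$ is totally isotropic with respect to $f$ if $f(w,w')=0$ for all $w,w'\in W$. For $\dim V=2m$, a complete symplectic spread of $V$ is a collection of $q^m+1$ totally isotropic $m$-dimensional subspaces whose union is $V$ and which intersect pairwise trivially; here $m=1$. $\mathrm{Sp}(V)$ is the group of isometries of $f$. *)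

(* Defs.v *)
From HB Require Import structures.
From mathcomp Require Import all_boot all_order all_algebra.
From mathcomp Require Import all_fingroup all_solvable all_field.

Set Implicit Arguments.
Unset Strict Implicit.
Unset Printing Implicit Defensive.

Import GRing.Theory.
Local Open Scope ring_scope.

(* sesquilinear.v states nondegeneracy for (skew-)Hermitian forms only; here   *)
(* the form is an arbitrary bilinear form, and "alternating" is f(v, v) = 0.   *)
Definition alternating (F : fieldType) (V : vectType F) (f : {biscalar V}) :=
  forall v : V, f v v = 0.

Definition nondegenerate_form (F : fieldType) (V : vectType F)
    (f : {biscalar V}) :=
  forall u : V, (forall v : V, f u v = 0) -> u = 0.

Definition totally_isotropic (F : fieldType) (V : vectType F)
    (f : {biscalar V}) (W : {vspace V}) :=
  forall w w' : V, w \in W -> w' \in W -> f w w' = 0.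

(* A linear isometry is encoded as a permutation of the finite set of vectors, *)
(* so that the natural action on vectors is 'P and the induced action on sets  *)
(* of vectors (in particular on subspaces) is 'P^*.                            *)
Definition Sp (F : finFieldType) (V : vectType F) (f : {biscalar V}) :
    {set {perm finvect_type V}} :=
  [set s : {perm finvect_type V} |
    [forall a : F, forall u, forall v, s (a *: u + v) == a *: s u + s v] &&
    [forall u, forall v, f (s u) (s v) == f u v]].

Lemma SpP (F : finFieldType) (V : vectType F) (f : {biscalar V})
    (s : {perm finvect_type V}) :
  reflect ((forall (a : F) u v, s (a *: u + v) = a *: s u + s v) /\
           (forall u v, f (s u) (s v) = f u v))
          (s \in Sp f).
Proof.
rewrite inE; apply: (iffP andP) => -[lin iso]; split.
- by move=> a u v; move/forallP/(_ a)/forallP/(_ u)/forallP/(_ v)/eqP: lin.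
- by move=> u v; move/forallP/(_ u)/forallP/(_ v)/eqP: iso.
- by apply/forallP=> a; apply/forallP=> u; apply/forallP=> v; apply/eqP.
- by apply/forallP=> u; apply/forallP=> v; apply/eqP.
Qed.

Lemma Sp_group_set (F : finFieldType) (V : vectType F) (f : {biscalar V}) :
  group_set (Sp f).
Proof.
apply/group_setP; split.
  by apply/SpP; split=> [a u v | u v]; rewrite !perm1.
move=> s t /SpP[slin siso] /SpP[tlin tiso]; apply/SpP.
by split=> [a u v | u v]; rewrite !permM ?slin ?tlin ?tiso ?siso.
Qed.

Canonical Sp_group (F : finFieldType) (V : vectType F) (f : {biscalar V}) :=
  Group (Sp_group_set f).

(* Subspaces are represented in S by their sets of vectors.                    *)
Definition complete_symplectic_spread (F : finFieldType) (V : vectType F)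
    (f : {biscalar V}) (m : nat) (S : {set {set finvect_type V}}) : Prop :=
  [/\ \dim {:V} = (2 * m)%N,
      #|S| = (#|F| ^ m + 1)%N,
      forall U : {set finvect_type V}, U \in S ->
        exists W : {vspace V},
          [/\ U = [set v : finvect_type V | (v : V) \in W], \dim W = m & totally_isotropic f W],
      \bigcup_(U in S) U = [set: finvect_type V]
    & forall U1 U2 : {set finvect_type V},
        U1 \in S -> U2 \in S -> U1 != U2 -> U1 :&: U2 = [set 0]].

Definition SL (n : nat) (F : finFieldType) : {set {'GL_n[F]}} :=
  [set A : {'GL_n[F]} | \det (GLval A) == 1].

Lemma SL_group_set (n : nat) (F : finFieldType) : group_set (SL n F).
Proof.
apply/group_setP; split; first by rewrite inE GL_1E det1.
by move=> A B; rewrite !inE GL_ME det_mulmx => /eqP-> /eqP->; rewrite mulr1.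
Qed.

Canonical SL_group (n : nat) (F : finFieldType) := Group (SL_group_set n F).

(* Main.v *)
(* The spread consists of all n = q + 1 lines. Let G be transitive on them. The  *)
(* derived series shows that a solvable G consists of signs +-1, which fix every *)
(* line, as soon as every nilpotent normal subgroup N of G does: if G^(n+1) is   *)
(* contained in {1, -1}, then G^(n) is nilpotent. If N fixes a line, it fixes    *)
(* all of them, hence consists of signs.                                         *)
(*   For p odd, let A be the centre of O_p(N) and a in A, not a sign. If a fixes *)
(* a line, it fixes at most 2, so the p-group A fixes one of them. Otherwise the *)
(* conjugates of a in G are a and a^-1, so C = C_G(a) has index at most 2, and   *)
(* elements outside C have square -1. As q = 1 mod 4, an element of square -1    *)
(* has an eigenvalue in F; this forces 4 to divide |C|, so that C contains an    *)
(* element of square -1, but an element of C fixing a line is a sign.            *)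
(*   So N is a 2-group, with orbits of length 1 or 2 as n = 2 mod 4, and length  *)
(* 2 is excluded by counting fixed points unless q = 5.                          *)
(*   For q = 5 the stabiliser of a line in a subgroup of order 24 embeds in F^*  *)
(* by its eigenvalue, the kernel consisting of elements of order 1 or 5, so that *)
(* all orbits have at least 6 elements.                                          *)

(* In a plane, a complete symplectic spread can only be the set of all lines ([spread_lines]), whose
   number q + 1 is 2 mod 4. The linear algebra needed concerns one isometry s: s + s^-1 is scalar
   ([Sp_trace]), three eigenlines make s a sign ([three_eigenlines]), and s^2 = -1 yields an
   eigenvector because -1 is a square in F ([Sp_squareN1]). By transitivity, a normal subgroup
   fixing one line consists of signs ([normal_fix_signs]). Counting powers of 2 in |G| shows that
   every element of an abelian normal subgroup has an eigenvector ([abelian_normal_fix]); this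
   settles odd p ([abelian_normal_odd]), a count of fixed points settles p = 2 ([normal_2group]),
   and [normal_nilpotent] combines the two. [transitive_not_solvable] then climbs the derived
   series. For q = 5, [stab_line_le] makes the orbits long enough, and [exists_SL23] produces the
   group from an explicit table. *)
Require Import Defs.
From HB Require Import structures.
From mathcomp Require Import all_boot all_order all_algebra.
From mathcomp Require Import all_fingroup all_solvable all_field.
From mathcomp Require Import ring zify.

Set Implicit Arguments.
Unset Strict Implicit.
Unset Printing Implicit Defensive.

Import GRing.Theory.
Local Open Scope group_scope.
Local Open Scope ring_scope.

(** * Isometries of a symplectic plane *)

(* Evaluation with values in V itself rather than in its finite alias, so that *)
(* the module operations of V are the ones seen by unification.                *)
Definition app (F : finFieldType) (V : vectType F)
  (s : {perm finvect_type V}) (v : V) : V := s v.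

Section SymplecticPlane.

Variables (F : finFieldType) (V : vectType F) (f : {biscalar V}).
Hypotheses (dimV : \dim {:V} = 2%N) (f_alt : alternating f)
  (f_nondeg : nondegenerate_form f).

Notation VT := (finvect_type V).
Implicit Types (u v w : V) (s : {perm VT}).

Lemma altC u v : f u v = - f v u.
Proof.
have := f_alt (u + v); rewrite linearDl !linearDr !f_alt add0r addr0.
by move/eqP; rewrite addr_eq0 => /eqP.
Qed.

(** Cramer's rule, with [f] as determinant: pairing a relation with [u] or [v] isolates one
    coefficient. *)
Lemma plane_decomp u v w : f u v != 0 ->
  w = (f w v / f u v) *: u + (f u w / f u v) *: v.
Proof.
move=> fuv; have fr : free [:: u; v].
  apply/freeP => /= k; rewrite !big_ord_recl big_ord0 /= addr0 => k0.
  have k0u : k ord0 = 0.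
    have := congr1 (fun x => f x v) k0; rewrite linearDl !linearZl_LR linear0l /=.
    by rewrite f_alt mulr0 addr0 => /eqP; rewrite mulf_eq0 (negPf fuv) orbF => /eqP.
  have k0v : k (lift ord0 ord0) = 0.
    have := congr1 (f u) k0; rewrite linearDr !linearZr_LR linear0r /=.
    by rewrite f_alt mulr0 add0r => /eqP; rewrite mulf_eq0 (negPf fuv) orbF => /eqP.
  by case=> [[|[|//]] lt]; [rewrite -k0u | rewrite -k0v]; congr (k _); apply: val_inj.
have : basis_of fullv [:: u; v].
  by rewrite basisEfree fr subvf /= dimV.
move=> /span_basis spanE; have : w \in <<[:: u; v]>>%VS by rewrite spanE memvf.
move/coord_span; rewrite !big_ord_recl big_ord0 /= addr0.
set x := coord _ _ _; set y := coord _ _ _ => ->.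
rewrite !linearDl !linearDr !linearZl_LR !linearZr_LR /= !f_alt.
by congr (_ *: _ + _ *: _); field.
Qed.

Lemma nondeg_ex v : v != 0 -> exists w, f v w != 0.
Proof.
move=> v0; have [/existsP[w]|] := boolP [exists w : VT, f v w != 0]; first by exists w.
rewrite negb_exists => /forallP w0; case/eqP: v0; apply: f_nondeg => w.
by apply/eqP; move: (w0 w); rewrite negbK.
Qed.

Lemma plane_colinear u v : v != 0 -> f u v = 0 -> exists c, u = c *: v.
Proof.
move=> /nondeg_ex[w fvw] fuv; exists (f u w / f v w).
by rewrite {1}(plane_decomp u fvw) [f v u]altC fuv oppr0 mul0r scale0r addr0.
Qed.

Lemma app_iso s u v : s \in Sp f -> f (app s u) (app s v) = f u v.
Proof. by case/SpP=> _; apply. Qed.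

Lemma app_lin s k u v : s \in Sp f ->
  app s (k *: u + v) = k *: app s u + app s v.
Proof. by case/SpP=> slin _; apply: slin. Qed.

Lemma appD s u v : s \in Sp f -> app s (u + v) = app s u + app s v.
Proof. by move=> /(app_lin 1 u v); rewrite !scale1r. Qed.

Lemma app0 s : s \in Sp f -> app s 0 = 0.
Proof. by move=> /(app_lin (-1) 0 0); rewrite scaler0 add0r scaleN1r addNr. Qed.

Lemma appZ s k u : s \in Sp f -> app s (k *: u) = k *: app s u.
Proof. by move=> sS; have := app_lin k u 0 sS; rewrite addr0 app0 // addr0. Qed.

Lemma appN s u : s \in Sp f -> app s (- u) = - app s u.
Proof. by move=> sS; rewrite -scaleN1r appZ // scaleN1r. Qed.

Lemma appM s1 s2 u : app (s1 * s2)%g u = app s2 (app s1 u).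
Proof. by rewrite /app permM. Qed.

Lemma app1 u : app 1%g u = u.
Proof. by rewrite /app perm1. Qed.

Lemma app_inj s : injective (app s).
Proof. exact: (@perm_inj VT s). Qed.

Lemma appK s : cancel (app s) (app s^-1%g).
Proof. by move=> u; rewrite -appM mulgV app1. Qed.

Lemma appVK s : cancel (app s^-1%g) (app s).
Proof. by move=> u; rewrite -appM mulVg app1. Qed.

Lemma app_neq0 s u : s \in Sp f -> (app s u != 0) = (u != 0).
Proof. by move=> sS; rewrite -(inj_eq (@app_inj s) u) app0. Qed.

Lemma eq_app s1 s2 : app s1 =1 app s2 -> s1 = s2.
Proof. by move=> e; apply/permP => u; apply: e. Qed.

Lemma app_adj s u v : s \in Sp f -> f (app s u) v = f u (app s^-1%g v).
Proof. by move=> sS; rewrite -{1}[v](appVK s) app_iso. Qed.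

Lemma form_inj u v : (forall w, f u w = f v w) -> u = v.
Proof.
move=> e; apply/eqP; rewrite -subr_eq0; apply/eqP; apply: f_nondeg => w.
by rewrite linearBl e subrr.
Qed.

Lemma SpV s : s \in Sp f -> s^-1%g \in Sp f.
Proof. exact: groupVr. Qed.

Lemma plane_nontrivial : exists u v, f u v = 1.
Proof.
have : vpick {:V} != 0 by rewrite vpick0 -dimv_eq0 dimV.
move=> /nondeg_ex[w fw]; exists (vpick {:V}), ((f (vpick {:V}) w)^-1 *: w).
by rewrite linearZr_LR /= mulVf.
Qed.

(* f (s u) v + f u (s v) is alternating, hence proportional to f u v. *)
Lemma Sp_trace s : s \in Sp f ->
  exists t, forall v, app s v + app s^-1%g v = t *: v.
Proof.
move=> sS; have [e1 [e2 e12]] := plane_nontrivial.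
exists (f (app s e1) e2 + f e1 (app s e2)) => v; apply: form_inj => w.
rewrite linearDl linearZl_LR /= [f (app s^-1%g v) w]app_adj ?SpV // invgK.
have e12n : f e1 e2 != 0 by rewrite e12 oner_neq0.
rewrite (plane_decomp v e12n) (plane_decomp w e12n) e12 !divr1.
move: (f v e2) (f e1 v) (f w e2) (f e1 w) => x y z k.
rewrite !(appD, appZ) // !linearDl !linearDr.
rewrite !linearZl_LR /=.
rewrite !linearZr_LR /=.
rewrite !f_alt [f (app s e1) e1]altC [f (app s e2) e2]altC [f (app s e2) e1]altC.
rewrite [f e2 (app s e1)]altC [f e2 e1]altC e12.
by ring.
Qed.

(* For nonzero v this is the span of v, since totally isotropic subspaces of a *)
(* plane have dimension at most 1.                                             *)
Definition line v : {set VT} := [set u : VT | f u v == 0].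

Definition lines : {set {set VT}} := [set line v | v : VT & (v : V) != 0].

Definition neg_perm : {perm VT} := perm (@oppr_inj VT).

Definition signs : {set {perm VT}} := [set 1%g; neg_perm].

Lemma app_neg u : app neg_perm u = - u.
Proof. by rewrite /app permE. Qed.

Lemma scalar_signs s k : s \in Sp f -> (forall v, app s v = k *: v) -> s \in signs.
Proof.
move=> sS sk; have [e1 [e2 e12]] := plane_nontrivial.
have := app_iso e1 e2 sS; rewrite !sk linearZl_LR linearZr_LR /= e12 mulr1.
move/eqP; rewrite -expr2 sqrf_eq1 => /orP[/eqP k1|/eqP k1]; rewrite !inE; apply/orP; [left|right];
 apply/eqP/eq_app => v; by rewrite ?app1 ?app_neg sk k1 ?scale1r ?scaleN1r.
Qed.

Lemma neg_Sp : neg_perm \in Sp f.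
Proof.
apply/SpP; split=> [k u v|u v]; last first.
  by rewrite -!/(app _ _) !app_neg linearNl linearNr opprK.
by rewrite !permE opprD scalerN.
Qed.

Lemma signs_scalar s : s \in signs -> exists k, forall v, app s v = k *: v.
Proof.
rewrite !inE => /orP[]/eqP->; [exists 1|exists (-1)] => v.
  by rewrite app1 scale1r.
by rewrite app_neg scaleN1r.
Qed.

(** Here s = s^-1, so [Sp_trace] reads 2 s v = t v and s is scalar. *)
Lemma Sp_square1 s : (2%:R : F) != 0 -> s \in Sp f -> (s * s)%g = 1%g -> s \in signs.
Proof.
move=> n2 sS ss; have [t ht] := Sp_trace sS.
have sV : (s^-1 = s)%g by apply/eqP; rewrite eq_sym eq_mulgV1 invgK ss.
apply: (@scalar_signs s (t / 2%:R)) => // v.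
have := ht v; rewrite sV -mulr2n -scaler_nat => /(congr1 (fun x : V => 2%:R^-1 *: x)).
by rewrite !scalerA mulVf // scale1r mulrC.
Qed.

(** Since (s - i)(s + i) = 0, a nonzero value of s + i is an eigenvector for i. Eigenvectors are
    expressed by [f (app s v) v = 0], which for nonzero [v] means that s v is a multiple of v. *)
Lemma Sp_squareN1 s (i : F) : i * i = -1 -> s \in Sp f -> (s * s)%g = neg_perm ->
  exists2 v, v != 0 & f (app s v) v = 0.
Proof.
move=> ii sS ss; have [e1 [e2 e12]] := plane_nontrivial.
have e10 : e1 != 0.
  by apply: contra_eq_neq e12 => ->; rewrite linear0l eq_sym oner_neq0.
have ss1 : app s (app s e1) = - e1 by rewrite -appM ss app_neg.
pose w := app s e1 + i *: e1.
have sw : app s w = i *: w.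
  by rewrite appD // appZ // ss1 scalerDr scalerA ii scaleN1r addrC.
have [w0|w0] := eqVneq w 0; [exists e1 | exists w] => //; last first.
  by rewrite sw linearZl_LR /= f_alt mulr0.
move/eqP: w0; rewrite addr_eq0 => /eqP->.
by rewrite linearNl linearZl_LR /= f_alt mulr0 oppr0.
Qed.

Lemma eigen s v : s \in Sp f -> v != 0 -> f (app s v) v = 0 ->
  exists k, app s v = k *: v.
Proof. by move=> sS v0 /(plane_colinear v0). Qed.

(** As s preserves [f], eigenvalues on two distinct lines have product 1; three such relations make
    the eigenvalues equal. *)
Lemma three_eigenlines s u v w : s \in Sp f -> f u v != 0 -> f u w != 0 -> f v w != 0 ->
  f (app s u) u = 0 -> f (app s v) v = 0 -> f (app s w) w = 0 -> s \in signs.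
Proof.
have nz x y : f x y != 0 -> x != 0 /\ y != 0.
  move=> fxy; split; apply: contraNneq fxy => ->; by rewrite ?linear0l ?linear0r.
move=> sS fuv fuw fvw; have [u0 v0] := nz _ _ fuv; have [_ w0] := nz _ _ fvw.
move=> /(eigen sS u0)[a sa] /(eigen sS v0)[b sb] /(eigen sS w0)[c sc].
have prod x y k l : f x y != 0 -> app s x = k *: x -> app s y = l *: y -> k * l = 1.
  move=> fxy sx sy; have := app_iso x y sS; rewrite sx sy linearZl_LR linearZr_LR /=.
  by rewrite mulrA => /eqP; rewrite -subr_eq0 -{2}[f x y]mul1r -mulrBl mulf_eq0
    (negPf fxy) orbF subr_eq0 => /eqP.
have ab := prod _ _ _ _ fuv sa sb; have ac := prod _ _ _ _ fuw sa sc.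
have bc := prod _ _ _ _ fvw sb sc.
have eab : a = b.
  have c0 : c != 0 by apply: contra_eq_neq ac => ->; rewrite mulr0 eq_sym oner_neq0.
  by apply: (mulIf c0); rewrite ac bc.
apply: (@scalar_signs s a) => // x; rewrite (plane_decomp x fuv) appD // !appZ // sa sb -eab.
by rewrite scalerDr !scalerA ![a * _]mulrC.
Qed.

(** Both w and a w are eigenvectors of c for the same eigenvalue, and they form a basis because a
    has no eigenvector. *)
Lemma centraliser_eigen (a c : {perm VT}) w : a \in Sp f -> c \in Sp f ->
  (forall v, v != 0 -> f (app a v) v != 0) -> commute a c ->
  w != 0 -> f (app c w) w = 0 -> c \in signs.
Proof.
move=> aS cS airr ac w0 /(eigen cS w0)[k ck]; apply: (@scalar_signs c k) => // v.
have faw := airr w w0; rewrite (plane_decomp v faw) appD // !appZ // ck -appM ac appM ck.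
by rewrite appZ // scalerDr !scalerA ![k * _]mulrC.
Qed.

End SymplecticPlane.

(** * The action on lines *)

Lemma atrans_normal_fix (aT : finGroupType) (sT : finType) (to : {action aT &-> sT})
    (G N : {group aT}) (S : {set sT}) (x : sT) :
  [transitive G, on S | to] -> (N <| G)%g -> x \in S -> x \in 'Fix_to(N) ->
  S \subset 'Fix_to(N).
Proof.
move=> trG /andP[_ nNG] xS /afixP fx; apply/subsetP => y yS.
have [g gG ->] := atransP2 trG xS yS; apply/afixP => n nN.
rewrite -actM conjgCV actM fx //.
by rewrite memJ_norm // groupV (subsetP nNG).
Qed.

Section Lines.

Variables (F : finFieldType) (V : vectType F) (f : {biscalar V}).
Hypotheses (dimV : \dim {:V} = 2%N) (f_alt : alternating f)
  (f_nondeg : nondegenerate_form f).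

Notation VT := (finvect_type V).
Notation to := ('P^*)%act.
Implicit Types (u v w : V) (s : {perm VT}).

Lemma linesP U : reflect (exists2 v : V, v != 0 & U = line f v) (U \in lines f).
Proof.
apply: (iffP imsetP) => [[v v0 ->]|[v v0 ->]]; exists v => //; move: v0; by rewrite inE.
Qed.

Lemma line_in v : v != 0 -> line f v \in lines f.
Proof. by move=> v0; apply/linesP; exists v. Qed.

Lemma mem_line u v : ((u : VT) \in line f v) = (f u v == 0).
Proof. by rewrite inE. Qed.

Lemma line_act s v : s \in Sp f -> to (line f v) s = line f (app s v).
Proof.
move=> sS; apply/setP => u; rewrite mem_line.
apply/imsetP/eqP => [[w wv ->]|uv].
  by move: wv; rewrite mem_line => /eqP <-; apply: (app_iso w v sS).
exists (app s^-1%g u); last by rewrite /= apermE; rewrite -/(app s _) appVK.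
by rewrite mem_line app_adj ?groupV // invgK uv.
Qed.

Lemma line_eqP u v : u != 0 -> v != 0 -> reflect (line f u = line f v) (f u v == 0).
Proof.
move=> u0 v0; apply: (iffP eqP) => [uv|e]; last first.
  by apply/eqP; rewrite -mem_line -e mem_line f_alt.
have [k uk] := plane_colinear dimV f_alt f_nondeg v0 uv.
have k0 : k != 0 by apply: contraNneq u0 => k0; rewrite uk k0 scale0r.
apply/setP => w; rewrite !mem_line uk linearZr_LR /= mulf_eq0.
by rewrite (negPf k0).
Qed.

Lemma fix_line s v : s \in Sp f -> v != 0 ->
  (line f v \in 'Fix_to[s]) = (f (app s v) v == 0).
Proof.
move=> sS v0; have sv0 : app s v != 0 by rewrite (app_neq0 _ sS).
by apply/afix1P/(line_eqP sv0 v0); rewrite line_act.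
Qed.

Lemma acts_lines (G : {group {perm VT}}) : G \subset Sp f -> [acts G, on lines f | to].
Proof.
move=> GS; apply/actsP => s sG; have sS := subsetP GS s sG => U.
have stab T t : t \in Sp f -> T \in lines f -> to T t \in lines f.
  by move=> tS /linesP[v v0 ->]; rewrite line_act // line_in // (app_neq0 _ tS).
apply/idP/idP => [|/stab]; last exact.
by move/(stab _ _ (groupVr sS)); rewrite actK.
Qed.

Lemma all_eigen s : s \in Sp f -> (forall v, v != 0 -> f (app s v) v = 0) ->
  s \in signs V.
Proof.
move=> sS all; have [e1 [e2 e12]] := plane_nontrivial dimV f_nondeg.
have nz x y : f x y != 0 -> x != 0 /\ y != 0.
  by move=> fxy; split; apply: contraNneq fxy => ->; rewrite ?linear0l ?linear0r.
(* The vectors e1, e2 and e1 + e2 span three distinct lines. *)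
have h1 : f e1 e2 != 0 by rewrite e12 oner_neq0.
have h2 : f e1 (e1 + e2) != 0 by rewrite linearDr f_alt add0r.
have h3 : f e2 (e1 + e2) != 0.
  by rewrite linearDr f_alt addr0 (altC f_alt) oppr_eq0.
have [n1 n2] := nz _ _ h1; have [_ n3] := nz _ _ h2.
by apply: (three_eigenlines dimV f_alt f_nondeg sS h1 h2 h3); apply: all.
Qed.

Section Transitive.

Variable G : {group {perm VT}}.
Hypotheses (GS : G \subset Sp f) (trG : [transitive G, on lines f | to]).

Lemma normal_fix_signs (N : {group {perm VT}}) U :
  (N <| G)%g -> U \in lines f -> U \in 'Fix_to(N) -> N \subset signs V.
Proof.
move=> nN UL Ufix; have fixL := atrans_normal_fix trG nN UL Ufix.
have NS : N \subset Sp f := subset_trans (normal_sub nN) GS.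
apply/subsetP => s sN; have sS := subsetP NS s sN.
apply: all_eigen => // v v0; apply/eqP; rewrite -fix_line //.
have := subsetP fixL _ (line_in v0) => /afixP fx.
by apply/afix1P; apply: fx.
Qed.

Lemma card_fix_le2 s : s \in Sp f -> s \notin signs V -> (#|'Fix_(lines f | to)[s]| <= 2)%N.
Proof.
move=> sS; apply: contraR; rewrite -ltnNge => /card_gt2P[U [W [X]]].
case=> -[]; rewrite !inE => /andP[/linesP[u u0 ->] fu] /andP[/linesP[v v0 ->] fv].
move=> /andP[/linesP[w w0 ->] fw] [uv vw wu].
have fixe x : x != 0 -> [set s] \subset [set a | to (line f x) a == line f x] ->
   f (app s x) x = 0.
  move=> x0 fx; apply/eqP; rewrite -fix_line //; apply/afix1P; apply/eqP.
  by move: fx; rewrite sub1set inE.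
suff: s \in signs V by rewrite !inE.
apply: (@three_eigenlines _ _ _ dimV f_alt f_nondeg s u v w) => //; try exact: fixe.
- by apply: contraNneq uv => h; apply/eqP/line_eqP => //; apply/eqP.
- by apply: contraNneq wu => h; apply/eqP/esym/line_eqP => //; apply/eqP.
- by apply: contraNneq vw => h; apply/eqP/line_eqP => //; apply/eqP.
Qed.

End Transitive.

End Lines.

(** * Normal subgroups of a transitive group *)

Lemma expg_sq (gT : groupType) (x : gT) : (x ^+ 2 = x * x)%g.
Proof. by rewrite expgS expg1. Qed.

Section AbelianNormal.

Variables (F : finFieldType) (V : vectType F) (f : {biscalar V}).
Hypotheses (dimV : \dim {:V} = 2%N) (f_alt : alternating f)
  (f_nondeg : nondegenerate_form f).
Variable i : F.
Hypotheses (two_neq0 : (2%:R : F) != 0) (sq_i : i * i = -1).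

Notation VT := (finvect_type V).
Notation to := ('P^*)%act.
Notation neg := (neg_perm V).
Implicit Types (u v w : V) (s : {perm VT}).

Lemma neg_neg : (neg * neg)%g = 1%g.
Proof. by apply: eq_app => v; rewrite appM !app_neg opprK app1. Qed.

Lemma oppv_neq v : v != 0 -> - v != v.
Proof.
apply: contra => /eqP e; have : 2%:R *: v = 0.
  by rewrite scaler_nat mulr2n -{1}e addNr.
by move/eqP; rewrite scaler_eq0 (negPf two_neq0).
Qed.

Lemma plane_neq0 : exists v : V, v != 0.
Proof.
have [e1 [e2 e12]] := plane_nontrivial dimV f_nondeg; exists e1.
by apply: contra_eq_neq e12 => ->; rewrite linear0l eq_sym oner_neq0.
Qed.

Lemma neg_neq1 : neg != 1%g.
Proof.
have [v v0] := plane_neq0; apply: contra (oppv_neq v0) => /eqP n1.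
by rewrite -(app_neg v) n1 app1.
Qed.

Lemma signs_sq s : s \in signs V -> (s * s = 1)%g.
Proof. by rewrite !inE => /orP[]/eqP->; rewrite ?mulg1 ?neg_neg. Qed.

Lemma card_signs (A : {set {perm VT}}) : (#|A :&: signs V| <= 2)%N.
Proof.
by apply: leq_trans (subset_leq_card (subsetIr _ _)) _; rewrite cards2; case: (_ != _).
Qed.

Lemma sq_neg_order s : (s * s)%g = neg -> #[s]%g = 4%N.
Proof.
move=> ss; have : (s ^+ (2 ^ 2) = 1)%g by rewrite (expgM s 2 2) !expg_sq ss neg_neg.
move/eqP; rewrite -order_dvdn => /(dvdn_pfactor _ _ (isT : prime 2))[[|[|[|k]]] //= _ o].
- by have /eqP := o; rewrite order_eq1 => /eqP s1; case/eqP: neg_neq1; rewrite -ss s1 mulg1.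
- by case/eqP: neg_neq1; rewrite -ss -expg_sq -[X in (s ^+ X)%g]o expg_order.
Qed.

(** A Sylow 2-subgroup is too large to consist of signs. A non-sign in it has order at least 4, and
    a power of order 4 has as its square an involution, which must be -1. *)
Lemma card4_sq_neg (H : {group {perm VT}}) : H \subset Sp f -> (4 %| #|H|)%N ->
  exists2 y, y \in H & (y * y)%g = neg.
Proof.
move=> HS H4; have [P sylP] := Sylow_exists 2 H.
have P4 : (4 <= #|P|)%N.
  rewrite (card_Hall sylP) p_part (@leq_pexp2l 2 2) // -(@pfactor_dvdn 2 2) //.
have : ~~ (P \subset signs V).
  apply/negP => /setIidPl PZ; have := card_signs P; rewrite PZ => h.
  by have := leq_trans P4 h.
case/subsetPn => s sP sZ; have sH := subsetP (pHall_sub sylP) s sP.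
have [k o] := p_natP (mem_p_elt (pHall_pgroup sylP) sP).
have sS := subsetP HS s sH.
case: k o => [|[|k]] o.
- by case/negP: sZ; move/eqP: o; rewrite order_eq1 !inE => ->.
- case/negP: sZ; apply: (Sp_square1 dimV f_alt f_nondeg two_neq0) => //.
  by rewrite -expg_sq -[X in (s ^+ X)%g]o expg_order.
pose y := (s ^+ (2 ^ k))%g.
have yH : y \in H by rewrite groupX.
have oy : #[y]%g = 4%N.
  rewrite orderXdiv o ?dvdn_exp2l //; last by rewrite -addn2 leq_addr.
  by rewrite !expnS mulnA mulnK // expn_gt0.
exists y => //.
have : (y * y)%g \in signs V.
  apply: (Sp_square1 dimV f_alt f_nondeg two_neq0); first by rewrite groupM // (subsetP HS).
  by rewrite -!expg_sq -expgM -[X in (_ ^+ X)%g]oy expg_order.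
rewrite !inE => /orP[/eqP y2|/eqP //].
have : (#[y]%g %| 2)%N by rewrite order_dvdn expg_sq y2.
by rewrite oy.
Qed.

Section Transitive.

Variable G : {group {perm VT}}.
Hypotheses (GS : G \subset Sp f) (trG : [transitive G, on lines f | to]).
Hypothesis lines_mod4 : (#|lines f| = 2 %[mod 4])%N.

Lemma card_stab_line U : U \in lines f -> (#|lines f| * #|'C_G[U | to]| = #|G|)%N.
Proof. by move=> UL; rewrite -(atransP trG U UL) card_orbit_stab. Qed.

(* b = a ^ g commutes with a and has the same trace, so (b - a)(b - a^-1) = 0; a *)
(* nonzero vector in the image of b - a^-1 is fixed by b a^-1, which centralises *)
(* the irreducible a and is therefore scalar.                                    *)
Lemma abelian_normal_conj (A : {group {perm VT}}) a g : (A <| G)%g -> abelian A ->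
  a \in A -> (forall v, v != 0 -> f (app a v) v != 0) -> g \in G ->
  (a ^ g = a)%g \/ (a ^ g = a^-1)%g.
Proof.
move=> /andP[AG nAG] abA aA airr gG; set b := (a ^ g)%g.
have aS := subsetP GS _ (subsetP AG _ aA); have gS := subsetP GS _ gG.
have bA : b \in A by rewrite memJ_norm // (subsetP nAG).
have bS := subsetP GS _ (subsetP AG _ bA).
have ab : commute a b by apply: (centsP abA).
have [t ta] := Sp_trace dimV f_alt f_nondeg aS.
have tb v : app b v + app b^-1%g v = t *: v.
  rewrite /b -conjVg !conjgE !appM -(appD _ _ gS) ta (appZ _ _ gS).
  by rewrite appVK.
have [/eqP|] := boolP (b == a^-1)%g; first by right.
move=> bN; left.
have /existsP[v bv] : [exists v : VT, app b v != app a^-1%g v].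
  apply: contraR bN; rewrite negb_exists => /forallP h; apply/eqP/eq_app => v.
  by apply/eqP; move: (h v); rewrite negbK.
pose w := app b v - app a^-1%g v.
have w0 : w != 0 by rewrite subr_eq0.
have bw : app b w = app a w.
  rewrite /w !(appD _ _ aS) !(appD _ _ bS) !(appN _ aS) !(appN _ bS) appVK.
  have -> : app b (app b v) = t *: app b v - v by rewrite -(tb (app b v)) appK addrK.
  have aVb : commute a^-1%g b by apply/commute_sym/commuteV/commute_sym.
  have -> : app b (app a^-1%g v) = app a^-1%g (app b v) by rewrite -!appM aVb.
  have -> : app a^-1%g (app b v) = t *: app b v - app a (app b v).
    by rewrite -(ta (app b v)) addrAC subrr add0r.
  by rewrite opprB addrACA [_ + app a _]addrC addrACA subrr addr0 addrC.
have : (b * a^-1)%g \in signs V.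
  apply: (centraliser_eigen dimV f_alt f_nondeg aS _ airr _ w0).
  - by rewrite groupM // groupV.
  - by apply: commuteM => //; apply: commuteV.
  - by rewrite appM bw appK f_alt.
rewrite !inE => /orP[/eqP e|/eqP e].
  by apply/eqP; rewrite eq_mulgV1 e.
by case/eqP: (oppv_neq w0); rewrite -app_neg -e appM bw appK.
Qed.

(* (a g)^2 = g^2, so comparing the characteristic polynomials of g and a g gives *)
(* t1 = t2 a for their traces; a is not scalar, hence t1 = t2 = 0.               *)
Lemma invert_sq_neg a g : a \in Sp f -> g \in Sp f ->
  (forall v, v != 0 -> f (app a v) v != 0) -> (a ^ g = a^-1)%g -> (g * g)%g = neg.
Proof.
move=> aS gS airr ag; have agS : (a * g)%g \in Sp f by rewrite groupM.
have agg : ((a * g) * (a * g) = g * g)%g.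
  by rewrite {1}(conjgC a g) ag -mulgA mulKg.
have [t1 h1] := Sp_trace dimV f_alt f_nondeg gS.
have [t2 h2] := Sp_trace dimV f_alt f_nondeg agS.
have t12 v : t1 *: v = t2 *: app a v.
  apply: (@app_inj _ _ g); rewrite !(appZ _ _ gS) -(appM a g).
  by rewrite -h1 -h2 !appK -[app g (app g v)]appM -[app _ (app _ v)]appM agg.
have [v v0] := plane_neq0.
have t20 : t2 = 0.
  apply/eqP; apply: contraT => t2n; case/eqP: (airr v v0).
  have -> : app a v = (t2^-1 * t1) *: v by rewrite -scalerA t12 scalerA mulVf // scale1r.
  by rewrite linearZl_LR /= f_alt mulr0.
apply: eq_app => u; have := h1 (app g u); rewrite appK app_neg appM -(appZ _ _ gS) t12.
by rewrite t20 scale0r (app0 gS) => /eqP; rewrite addr_eq0 => /eqP.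
Qed.

(** Otherwise the centraliser contains some y with y^2 = -1; y has an eigenvector, hence is a sign,
    but signs have square 1. *)
Lemma cent_irred_card4 a : a \in Sp f ->
  (forall v, v != 0 -> f (app a v) v != 0) -> ~~ (4 %| #|'C_G[a]%g|)%N.
Proof.
move=> aS airr; apply/negP => /card4_sq_neg[].
  by apply: subset_trans GS; apply: subsetIl.
move=> y /setIP[yG /cent1P ya] yy; have yS := subsetP GS _ yG.
have [v v0 yv] := Sp_squareN1 dimV f_alt f_nondeg sq_i yS yy.
have := centraliser_eigen dimV f_alt f_nondeg aS yS airr (commute_sym ya) v0 yv.
by move/signs_sq; rewrite yy => /eqP; rewrite (negPf neg_neq1).
Qed.

Lemma lines_even : (2 %| #|lines f|)%N.
Proof. by move: lines_mod4; clear; lia. Qed.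

Lemma lines_inhab : exists v : V, v != 0 /\ line f v \in lines f.
Proof. by have [v v0] := plane_neq0; exists v; split => //; apply: line_in. Qed.

Lemma abelian_normal_fix (A : {group {perm VT}}) a : (A <| G)%g -> abelian A ->
  a \in A -> exists2 v, v != 0 & f (app a v) v = 0.
Proof.
move=> nA abA aA.
have [/existsP[v /andP[v0 /eqP av]]|] :=
  boolP [exists v : VT, ((v : V) != 0) && (f (app a v) v == 0)]; first by exists v.
rewrite negb_exists => /forallP ex; exfalso.
have airr v : v != 0 -> f (app a v) v != 0.
  by move=> v0; have := ex v; rewrite v0.
have aG := subsetP (normal_sub nA) _ aA; have aS := subsetP GS _ aG.
case/negP: (cent_irred_card4 aS airr).
have cls : a ^: G \subset [set a; a^-1]%g.
  apply/subsetP => _ /imsetP[g gG ->]; rewrite !inE.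
  by have [->|->] := abelian_normal_conj nA abA aA airr gG; rewrite eqxx ?orbT.
have idx : (#|G : 'C_G[a]|%g <= 2)%N.
  rewrite index_cent1; apply: leq_trans (subset_leq_card cls) _.
  by rewrite cards2; case: (_ != _).
have LG := Lagrange (subsetIl G 'C[a]%g).
(* If G centralises a, an involution of G is -1, which fixes every line; so line stabilisers have
   even order, and as the number of lines is even, 4 divides |G|. *)
have [GC|] := boolP (G \subset 'C[a]%g).
  rewrite (setIidPl GC); have [v [v0 vL]] := lines_inhab.
  have cG := card_stab_line vL.
  have G2 : (2 %| #|G|)%N by rewrite -cG dvdn_mulr // lines_even.
  have [s sG o] := Cauchy (isT : prime 2) G2.
  have s2 : (s * s = 1)%g by rewrite -(expg_order s) o expg_sq.
  have := Sp_square1 dimV f_alt f_nondeg two_neq0 (subsetP GS _ sG) s2.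
  rewrite !inE => /orP[/eqP s1|/eqP sN].
    by move: o; rewrite s1 order1.
  have : s \in 'C_G[line f v | to].
    rewrite inE sG; apply/astab1P; rewrite sN (line_act _ (neg_Sp f)).
    by apply/setP => u; rewrite !mem_line app_neg linearNr oppr_eq0.
  move/order_dvdG; rewrite o -cG => h; have := dvdn_mul lines_even h; by [].
(* Otherwise g inverts a, so g has order 4 and fixes a line. Then 8 divides |G|, and 4 divides the
   order of the centraliser, of index at most 2. *)
case/subsetPn => g gG gC; have gS := subsetP GS _ gG.
have gg : (g * g)%g = neg.
  apply: (invert_sq_neg aS gS airr).
  have [ag|//] := abelian_normal_conj nA abA aA airr gG.
  by case/negP: gC; apply/cent1P; rewrite /commute [RHS]conjgC ag.
have [v v0 gv] := Sp_squareN1 dimV f_alt f_nondeg sq_i gS gg.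
have cG := card_stab_line (line_in f v0).
have : g \in 'C_G[line f v | to].
  rewrite inE gG; apply/astab1P/afix1P.
  by rewrite (fix_line dimV f_alt f_nondeg) // gv.
move/order_dvdG; rewrite (sq_neg_order gg) => h.
have := dvdn_mul lines_even h; rewrite cG -LG; move: idx.
have := indexg_gt0 G 'C_G[a]%g.
case: (#|G : _|%g) => [//|[|[|//]]] _ _; rewrite ?muln1 => h8.
  by apply: dvdn_trans h8.
by move: h8; rewrite -[(2 * 4)%N]/(4 * 2)%N dvdn_pmul2r.
Qed.

End Transitive.
End AbelianNormal.

Lemma card_orbit_normal (aT : finGroupType) (sT : finType) (to : {action aT &-> sT})
    (G N : {group aT}) (S : {set sT}) (x y : sT) :
  [transitive G, on S | to] -> (N <| G)%g -> x \in S -> y \in S ->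
  #|orbit to N x| = #|orbit to N y|.
Proof.
move=> trG /andP[_ nNG] xS yS; have [g gG ->] := atransP2 trG xS yS.
have nNg := normP (subsetP nNG _ gG).
rewrite !card_orbit -!divgS ?subsetIl // /=.
by congr (_ %/ _)%N; rewrite astab1_act -{2}nNg -conjIg cardJg.
Qed.

Lemma card_orbit_normal_dvd (aT : finGroupType) (sT : finType) (to : {action aT &-> sT})
    (G N : {group aT}) (S : {set sT}) (x : sT) :
  [transitive G, on S | to] -> (N <| G)%g -> x \in S ->
  (#|orbit to N @: S| * #|orbit to N x| = #|S|)%N.
Proof.
move=> trG nN xS.
rewrite -(@acts_sum_card_orbit _ _ _ to N S); last first.
  by apply: subset_trans (normal_sub nN) (atrans_acts trG).
rewrite -sum_nat_const; apply: eq_bigr => _ /imsetP[y yS ->].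
exact: card_orbit_normal trG nN _ _.
Qed.

(** * Nilpotent normal subgroups of a transitive group *)

Section NormalSubgroups.

Variables (F : finFieldType) (V : vectType F) (f : {biscalar V}).
Hypotheses (dimV : \dim {:V} = 2%N) (f_alt : alternating f)
  (f_nondeg : nondegenerate_form f).
Variable i : F.
Hypotheses (two_neq0 : (2%:R : F) != 0) (sq_i : i * i = -1).

Notation VT := (finvect_type V).
Notation to := ('P^*)%act.
Notation neg := (neg_perm V).
Implicit Types (u v w : V) (s : {perm VT}).

Variable G : {group {perm VT}}.
Hypotheses (GS : G \subset Sp f) (trG : [transitive G, on lines f | to]).
Hypotheses (lines_mod4 : (#|lines f| = 2 %[mod 4])%N) (lines_gt : (9 < #|lines f|)%N).

(** A non-sign a in A fixes one or two lines, which A permutes. Neither number is 0 mod p, so the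
    p-group A fixes one of them. *)
Lemma abelian_normal_odd (A : {group {perm VT}}) p : prime p -> odd p -> (A <| G)%g ->
  abelian A -> p.-group A -> A \subset signs V.
Proof.
move=> p_pr p_odd nA abA pA; apply: contraT => /subsetPn[a aA aZ].
have aS := subsetP GS _ (subsetP (normal_sub nA) _ aA).
have [v v0 av] := abelian_normal_fix dimV f_alt f_nondeg two_neq0 sq_i GS trG lines_mod4 nA abA aA.
have vfix : line f v \in 'Fix_(lines f | to)[a].
  by rewrite inE line_in // (fix_line dimV f_alt f_nondeg) // av eqxx.
have le2 := card_fix_le2 dimV f_alt f_nondeg aS aZ.
have gt0 : (0 < #|'Fix_(lines f | to)[a]|)%N by apply/card_gt0P; exists (line f v).
have acts : [acts A, on 'Fix_(lines f | to)[a] | to].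
  apply/subsetP => s sA; rewrite inE /=; apply/andP; split; first by rewrite inE.
  rewrite inE; apply/subsetP => U /setIP[UL /afix1P Ua]; rewrite inE in_setI.
  have sG := subsetP (normal_sub nA) _ sA.
  rewrite (acts_act (atrans_acts trG)) // UL /=.
  have sa : commute s a by apply: (centsP abA).
  by apply/afix1P; rewrite -actM sa actM Ua.
have := pgroup_fix_mod pA acts.
have [->|/set0Pn[U /setIP[/setIP[UL _] Ufix]] _] :=
  eqVneq ('Fix_('Fix_(lines f | to)[a] | to)(A)) set0.
  rewrite cards0 mod0n => /eqP; rewrite -/(dvdn _ _) => /(dvdn_leq gt0) p_le.
  by have := leq_trans (odd_prime_gt2 p_odd p_pr) (leq_trans p_le le2).
case/negP: aZ; apply: (subsetP (normal_fix_signs dimV f_alt f_nondeg GS trG nA UL Ufix) _ aA).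
Qed.

Lemma signs_odd_trivial (A : {group {perm VT}}) p : prime p -> odd p ->
  p.-group A -> A \subset signs V -> A :=: 1%g.
Proof.
move=> p_pr p_odd pA AZ; apply/trivgP/subsetP => s sA.
have /eqP : (s ^+ 2 = 1)%g by rewrite expg_sq signs_sq // (subsetP AZ).
rewrite -order_dvdn => s2; have [k o] := p_natP (mem_p_elt pA sA).
have /eqP co : coprime #[s]%g 2 by rewrite o coprimeXl // coprime_sym coprime2n.
by rewrite inE -order_eq1 -dvdn1 -co dvdn_gcd dvdnn s2.
Qed.

(* Orbits of N have a common length dividing n = #|lines f| = 2 mod 4 and |N|. If  *)
(* it is 2, counting fixed points gives n|N|/2 <= 2|N| + 2n, while |N| >= 8.       *)
Lemma normal_2group (N : {group {perm VT}}) : (N <| G)%g -> 2.-group N -> N \subset signs V.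
Proof.
move=> nN pN; apply: contraT => /subsetPn[s sN sZ].
have NG := normal_sub nN; have NS := subset_trans NG GS; have sS := subsetP NS _ sN.
have orb U (UL : U \in lines f) := card_orbit_normal_dvd trG nN UL.
have orbs U (UL : U \in lines f) : #|orbit to N U| = 2%N.
  have d2 : (#|orbit to N U| %| #|N|)%N := dvdn_orbit _ _ _.
  (* The length is a power of 2 dividing n = 2 mod 4; length 1 would be a fixed line. *)
  have [[|[|k]] // o] := p_natP (pnat_dvd d2 pN).
    case/negP: sZ; apply: (subsetP _ s sN).
    apply: (normal_fix_signs dimV f_alt f_nondeg GS trG nN UL).
    by apply/orbit1P/card_orbit1.
  have := orb U UL; rewrite o !expnS; move: lines_mod4; clear; lia.
have sq_fix t W : t \in N -> W \in lines f -> to (to W t) t = W.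
  move=> tN WL; have [e|ne] := eqVneq (to W t) W; first by rewrite !e.
  have WWt : orbit to N W = [set W; to W t].
    apply/esym/eqP; rewrite eqEcard orbs // cards2 eq_sym ne andbT.
    by apply/subsetP => X; rewrite !inE => /orP[]/eqP->; rewrite ?orbit_refl // mem_orbit.
  have : to (to W t) t \in orbit to N W by rewrite -actM mem_orbit // groupM.
  rewrite WWt !inE => /orP[/eqP//|/eqP e]; case/eqP: ne; exact: (act_inj to t).
have sq_signs t : t \in N -> (t * t)%g \in signs V.
  move=> tN; have tS := subsetP NS _ tN.
  apply: (all_eigen dimV f_alt f_nondeg); first by rewrite groupM.
  move=> w w0; apply/eqP; rewrite -(fix_line dimV f_alt f_nondeg) ?groupM //.
  by apply/afix1P; rewrite actM sq_fix // line_in.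
have ss : (s * s)%g = neg.
  have := sq_signs s sN; rewrite !inE => /orP[/eqP s2|/eqP //].
  by case/negP: sZ; apply: (Sp_square1 dimV f_alt f_nondeg two_neq0 sS s2).
have [w w0 sw] := Sp_squareN1 dimV f_alt f_nondeg sq_i sS ss.
have wL := line_in f w0.
have N8 : (8 %| #|N|)%N.
  rewrite -(card_orbit_stab to N (line f w)) orbs // -[8%N]/(2 * 4)%N dvdn_pmul2l //.
  rewrite -(sq_neg_order dimV f_nondeg two_neq0 ss) order_dvdG //.
  rewrite inE sN; apply/astab1P/afix1P.
  by rewrite (fix_line dimV f_alt f_nondeg) // sw.
have {}N8 : (8 <= #|N|)%N by rewrite dvdn_leq // cardG_gt0.
have := Frobenius_Cauchy (subset_trans NG (atrans_acts trG)).
have := orb _ wL; rewrite orbs // => no sumF.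
have : (\sum_(a in N) #|'Fix_(lines f | to)[a]| <=
        \sum_(a in N) (2 + (a \in signs V) * #|lines f|))%N.
  apply: leq_sum => a aN; have [aZ|aZ] := boolP (a \in signs V).
    by rewrite mul1n; apply: leq_trans (subset_leq_card (subsetIl _ _)) (leq_addl _ _).
  by rewrite mul0n addn0 (card_fix_le2 dimV f_alt f_nondeg) // (subsetP NS).
rewrite sumF big_split /= sum_nat_const -big_distrl /= -big_mkcondr /= sum1_card.
set k := #|_|; have : (k <= 2)%N.
  apply: leq_trans (card_signs N); apply: subset_leq_card; apply/subsetP => a.
  by rewrite in_setI unfold_in.
move: no N8 lines_gt; set n := #|lines f|; set m := #|N|; set o := #|_|.
clearbody n m k o; clear => on m8 n9 k2 bnd.
(* With n = 2o, the count becomes m(o - 2) <= 2n = 4o. As m >= 8, this forces o <= 4, against n >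
   9. *)
have h1 : (8 * (o - 2) <= m * (o - 2))%N by rewrite leq_mul2r m8 orbT.
have h2 : (k * n <= 2 * n)%N by rewrite leq_mul2r k2 orbT.
rewrite !mulnBr [(m * o)%N]mulnC in h1.
set om := (o * m)%N in bnd h1; set kn := (k * n)%N in bnd h2.
clearbody om kn; lia.
Qed.

(** For odd p the centre of O_p(N) is an abelian normal p-subgroup of G, hence made of signs, hence
    trivial. So the Sylow p-subgroup O_p(N) is trivial, and N is a 2-group. *)
Lemma normal_nilpotent (N : {group {perm VT}}) : (N <| G)%g -> nilpotent N -> N \subset signs V.
Proof.
move=> nN nilN; apply: normal_2group => //; apply/pgroupP => p p_pr pN.
have [->//|p_odd] := even_prime p_pr.
have nO : ('O_p(N) <| G)%g by apply: char_normal_trans (pcore_char _ _) nN.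
have nZ : ('Z('O_p(N)) <| G)%g by apply: char_normal_trans (center_char _) nO.
have pO : p.-group 'O_p(N) := pcore_pgroup _ _.
have pZ : p.-group 'Z('O_p(N)) := pgroupS (center_sub _) pO.
have Z1 : 'Z('O_p(N)) = 1%g.
  apply: (signs_odd_trivial p_pr p_odd pZ).
  exact: (abelian_normal_odd p_pr p_odd nZ (center_abelian _) pZ).
have O1 := trivg_center_pgroup pO Z1.
have := card_Hall (nilpotent_pcore_Hall p nilN).
rewrite O1 cards1 => /esym/eqP; rewrite p_part_eq1 => /negP[].
by rewrite mem_primes p_pr cardG_gt0.
Qed.

Lemma transitive_not_solvable : ~ solvable G.
Proof.
move=> solG; have GZ : G \subset signs V.
  have [n Gn] := derivedP _ solG.
  have {Gn}: G^`(n)%g \subset signs V.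
    by rewrite Gn sub1set !inE eqxx.
  elim: n => [|n IHn] // Dn; apply: IHn.
  apply: normal_nilpotent; first exact: der_normal.
  (* Signs commute with all isometries, so G^(n+1) is central in G^(n), whose quotient by its centre
     is therefore abelian. *)
  rewrite -quotient_center_nil; apply: abelian_nil; apply: sub_der1_abelian.
  rewrite derg1 -dergSn subsetI der_subS /=.
  apply/centsP => s sD t tD; have := subsetP Dn _ sD.
  have tS := subsetP GS _ (subsetP (der_sub _ _) _ tD).
  rewrite !inE => /orP[]/eqP->; first by rewrite /commute mul1g mulg1.
  by apply: eq_app => v; rewrite !appM !app_neg (appN _ tS).
have [v [v0 vL]] := lines_inhab dimV f_nondeg.
have fixv : line f v \in 'Fix_to(G).
  apply/afixP => s sG; have sS := subsetP GS _ sG.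
  have [k sk] := signs_scalar (subsetP GZ _ sG).
  by apply/afix1P; rewrite (fix_line dimV f_alt f_nondeg) // sk linearZl_LR /= f_alt mulr0.
have := atransP trG _ vL; move/orbit1P: fixv => -> e.
by move: lines_gt; rewrite -e cards1.
Qed.

End NormalSubgroups.

(** * Spreads of a plane *)

(** Write |F| = 4k + 1. If x^(2k) were never -1, all 4k nonzero elements would be roots of X^(2k) -
    1. *)
Lemma finField_sqrtN1 (F : finFieldType) : (#|F| = 1 %[mod 4])%N ->
  exists i : F, i * i = -1.
Proof.
move=> F4; have F1 := finNzRing_gt1 F.
pose k := (#|F| %/ 4)%N; have Fk : #|F| = (k * 4).+1.
  by rewrite {1}(divn_eq #|F| 4) F4 addn1.
have k0 : (0 < k)%N by move: F1; rewrite Fk; case: (k).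
have [/existsP[x /eqP xk]|] := boolP [exists x : F, x ^+ (k * 2) == -1].
  by exists (x ^+ k); rewrite -expr2 -exprM.
rewrite negb_exists => /forallP no.
have allroot : all (2 * k).-unity_root (rem 0 (enum F)).
  apply/allP => x; rewrite mem_rem_uniq ?enum_uniq // !inE => /andP[x0 _].
  have : x ^+ (k * 4) = 1.
    apply: (mulfI x0); rewrite -exprS -Fk mulr1; exact: expf_card.
  rewrite -[4%N]/(2 * 2)%N mulnA exprM => /eqP; rewrite sqrf_eq1 (negPf (no x)) orbF.
  by rewrite unity_rootE mulnC.
have := max_unity_roots _ allroot (rem_uniq _ (enum_uniq F)).
rewrite size_rem ?mem_enum // -cardE Fk /= muln_gt0 k0 => /(_ isT).
by rewrite mulnC leq_pmul2r.
Qed.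

Section Spread.

Variables (F : finFieldType) (V : vectType F) (f : {biscalar V}).
Hypotheses (dimV : \dim {:V} = 2%N) (f_alt : alternating f)
  (f_nondeg : nondegenerate_form f).

Notation VT := (finvect_type V).
Notation to := ('P^*)%act.
Implicit Types (u v w : V) (s : {perm VT}).

Lemma line_vline v : v != 0 -> line f v = [set u : VT | (u : V) \in <[v]>%VS].
Proof.
move=> v0; apply/setP => u; rewrite mem_line inE; apply/eqP/vlineP.
  exact: plane_colinear.
by case=> k ->; rewrite linearZl_LR /= f_alt mulr0.
Qed.

(** Members of the spread are lines. Conversely, a line through v equals the member that covers
    v. *)
Lemma spread_lines S : complete_symplectic_spread f 1 S -> S = lines f.
Proof.
case=> _ _ Sdim Scov _.
have SL U : U \in S -> U \in lines f.
  case/Sdim => W [-> W1 _]; have v0 : vpick W != 0 by rewrite vpick0 -dimv_eq0 W1.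
  apply/linesP; exists (vpick W) => //; rewrite line_vline //.
  suff e : W = <[vpick W]>%VS by rewrite -e.
  by apply/esym/eqP; rewrite eqEdim -memvE memv_pick /= W1 dim_vline v0.
apply/eqP; rewrite eqEsubset; apply/andP; split; apply/subsetP => // U.
case/linesP => v v0 ->; have : (v : VT) \in \bigcup_(U in S) U by rewrite Scov inE.
case/bigcupP => W WS vW; have /linesP[u u0 Wu] := SL W WS.
suff -> : line f v = W by [].
by rewrite Wu; apply/(line_eqP dimV f_alt f_nondeg) => //; rewrite -mem_line -Wu.
Qed.

Lemma card_lines : #|lines f| = (#|F| + 1)%N.
Proof.
have [e1 [e2 e12]] := plane_nontrivial dimV f_nondeg.
(* Affine chart of the projective line: the lines of e2 + c e1, with the line of e1 as point at
   infinity. *)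
pose g (c : F) : V := e2 + c *: e1.
have e10 : e1 != 0.
  by apply: contra_eq_neq e12 => ->; rewrite linear0l eq_sym oner_neq0.
have e1g c : f e1 (g c) = 1 by rewrite linearDr linearZr_LR /= f_alt mulr0 addr0.
have g0 c : g c != 0.
  by apply: contra_eq_neq (e1g c) => ->; rewrite linear0r eq_sym oner_neq0.
have -> : lines f = line f e1 |: [set line f (g c) | c : F].
  apply/setP => U; apply/linesP/setU1P => [[v v0 ->]|[->|/imsetP[c _ ->]]]; last 2 first.
  - by exists e1.
  - by exists (g c).
  have [fv|fv] := eqVneq (f v e1) 0.
    by left; apply/(line_eqP dimV f_alt f_nondeg) => //; apply/eqP.
  right; apply/imsetP; exists (- f v e2 / f v e1) => //.
  apply/(line_eqP dimV f_alt f_nondeg) => //.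
  by rewrite linearDr linearZr_LR /= divfK // subrr.
rewrite cardsU1 card_imset; last first.
  move=> c d /(line_eqP dimV f_alt f_nondeg (g0 c) (g0 d)).
  rewrite !linearDl !linearDr !linearZl_LR !linearZr_LR /= !f_alt (altC f_alt e2 e1) e12.
  rewrite !mulr0 add0r addr0 mulr1 mulrN1 addrC subr_eq0 => /eqP //.
rewrite addnC; congr (_ + _)%N; apply/eqP; rewrite eqb1.
apply/imsetP => -[c _ /(line_eqP dimV f_alt f_nondeg e10 (g0 c))].
by rewrite e1g oner_eq0.
Qed.

Lemma lines_spread : complete_symplectic_spread f 1 (lines f).
Proof.
split=> //.
- by rewrite card_lines expn1.
- move=> U /linesP[v v0 ->]; exists <[v]>%VS; split.
  + exact: line_vline.
  + by rewrite dim_vline v0.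
  move=> w w' /vlineP[k ->] /vlineP[l ->].
  by rewrite linearZl_LR linearZr_LR /= f_alt !mulr0.
- apply/setP => v; rewrite inE; apply/bigcupP.
  have [v0|v0] := eqVneq (v : V) 0.
    have [w w0] := plane_neq0 dimV f_nondeg.
    by exists (line f w); rewrite ?line_in // mem_line v0 linear0l.
  by exists (line f v); rewrite ?line_in // mem_line f_alt.
- move=> _ _ /linesP[u u0 ->] /linesP[v v0 ->] uv; apply/setP => w.
  rewrite in_setI !mem_line inE; apply/andP/eqP => [[wu wv]|->]; last first.
    by rewrite !linear0l.
  apply/eqP; apply: contraNT uv => w0.
  have /(line_eqP dimV f_alt f_nondeg w0 u0) <- := wu.
  by have /(line_eqP dimV f_alt f_nondeg w0 v0) <- := wv.
Qed.

(** Eigenvalue 1 forces trace 2, so (s - 1)^2 = 0. In characteristic 5 this gives s^5 = 1. *)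
Lemma unipotent_pow u s n : s \in Sp f -> u != 0 -> app s u = u ->
  forall v, app (s ^+ n)%g v = v + n%:R *: (app s v - v).
Proof.
move=> sS u0 su v; have [t ht] := Sp_trace dimV f_alt f_nondeg sS.
have t2 : t = 2%:R.
  have : (t - 2%:R) *: u = 0.
    rewrite scalerBl -ht su -{2}su appK scaler_nat mulr2n subrr //.
  by move/eqP; rewrite scaler_eq0 (negPf u0) orbF subr_eq0 => /eqP.
have sd : app s (app s v - v) = app s v - v.
  rewrite (appD _ _ sS) (appN _ sS); have := ht (app s v); rewrite appK t2.
  rewrite scaler_nat mulr2n => h; apply: (addIr (app s v)).
  by rewrite subrK; apply: (addIr v); rewrite h addrAC subrK.
elim: n => [|n IHn]; first by rewrite expg0 app1 scale0r addr0.
rewrite expgSr appM IHn (appD _ _ sS) (appZ _ _ sS) sd.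
by rewrite -natr1 scalerDl scale1r [n%:R *: _ + _]addrC addrA [v + _]addrC subrK.
Qed.

(** * Line stabilisers in characteristic 5 *)

Section Q5.
Hypothesis F5 : 5 \in [pchar F].

(** The eigenvalue embeds the stabiliser in the nonzero scalars: if s and t share it, s t^-1 fixes
    v, so its order divides both 5 and |H|. *)
Lemma stab_line_le (H : {group {perm VT}}) v : H \subset Sp f -> coprime #|H| 5 ->
  v != 0 -> (#|'C_H[line f v | to]| <= #|F|.-1)%N.
Proof.
move=> HS co v0; have [w vw] := nondeg_ex f_nondeg v0.
pose k (s : {perm VT}) := f (app s v) w / f v w.
have sk s : s \in 'C_H[line f v | to] -> app s v = k s *: v.
  case/setIP => sH /astab1P/afix1P; have sS := subsetP HS _ sH.
  rewrite (fix_line dimV f_alt f_nondeg) // => /eqP /(eigen dimV f_alt f_nondeg sS v0)[c sc].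
  by rewrite /k sc linearZl_LR /= mulfK.
rewrite -(cardC1 (0 : F)) -(@card_in_imset _ _ k).
  apply: subset_leq_card; apply/subsetP => _ /imsetP[s sC ->].
  rewrite inE /=; apply: contraTneq v0 => k0.
  have sS : s \in Sp f by rewrite (subsetP HS) //; case/setIP: sC.
  by rewrite -(app_neq0 v sS) sk // k0 scale0r eqxx.
move=> s t sC tC kst; have sH := subsetP (subsetIl _ _) _ sC.
have tH := subsetP (subsetIl _ _) _ tC.
apply/eqP; rewrite eq_mulgV1 -order_eq1 -dvdn1.
have stH : (s * t^-1)%g \in H by rewrite groupM ?groupV.
have stS := subsetP HS _ stH.
have stv : app (s * t^-1)%g v = v by rewrite appM sk // kst -sk // appK.
rewrite -(eqP co) dvdn_gcd order_dvdG //= order_dvdn; apply/eqP/eq_app => x.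
by rewrite (unipotent_pow 5 stS v0 stv) (pcharf0 F5) scale0r addr0 app1.
Qed.

End Q5.
End Spread.

(** * SL(2,3) in SL(2,5) *)

Lemma eqr_nat_mod (R : nzRingType) p m n :
  p \in [pchar R] -> m%:R = n%:R :> R -> (m = n %[mod p])%N.
Proof.
move=> pR; wlog le_nm : m n / (n <= m)%N => [IH|] e.
  by have [le|/ltnW le] := leqP n m; [apply: IH | apply/esym/IH].
by apply/eqP; rewrite eqn_mod_dvd // (dvdn_pcharf pR) natrB // e subrr.
Qed.

(** Entries of a 2x2 matrix, row by row, as natural residues, so that identities over the whole
    table are decided by computation. *)
Notation quad := ((nat * nat) * (nat * nat))%type.

Definition quad1 : quad := ((1, 0), (0, 1))%N.

Definition quad_mul (n : nat) (x y : quad) : quad :=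
  let: ((a, b), (c, d)) := x in let: ((a', b'), (c', d')) := y in
  (((a * a' + b * c') %% n, (a * b' + b * d') %% n),
   ((c * a' + d * c') %% n, (c * b' + d * d') %% n))%N.

(* The factor n.-1 stands for -1 modulo n. *)
Definition quad_det (n : nat) (x : quad) : nat :=
  let: ((a, b), (c, d)) := x in ((a * d + n.-1 * (b * c)) %% n)%N.

(* Graph of the embedding of SL(2,3) in SL(2,5) sending (1 1; 0 1) to (0 1; 4 4) *)
(* and (1 0; 1 1) to (2 1; 3 2).                                                 *)
Definition SL23_table : seq (quad * quad) := [::
   (((0,1),(2,0)), ((3,0),(1,2))); (((0,1),(2,1)), ((2,2),(1,4)));
   (((0,1),(2,2)), ((0,3),(3,4))); (((0,2),(1,0)), ((2,0),(4,3)));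
   (((0,2),(1,1)), ((0,2),(2,1))); (((0,2),(1,2)), ((3,3),(4,1)));
   (((1,0),(0,1)), ((1,0),(0,1))); (((1,0),(1,1)), ((2,1),(3,2)));
   (((1,0),(2,1)), ((2,4),(2,2))); (((1,1),(0,1)), ((0,1),(4,4)));
   (((1,1),(1,2)), ((4,1),(3,1))); (((1,1),(2,0)), ((1,3),(3,0)));
   (((1,2),(0,1)), ((4,4),(1,0))); (((1,2),(1,0)), ((4,3),(4,2)));
   (((1,2),(2,2)), ((2,3),(0,3))); (((2,0),(0,2)), ((4,0),(0,4)));
   (((2,0),(1,2)), ((3,1),(3,3))); (((2,0),(2,2)), ((3,4),(2,3)));
   (((2,1),(0,2)), ((1,1),(4,0))); (((2,1),(1,1)), ((3,2),(0,2)));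
   (((2,1),(2,0)), ((1,2),(1,3))); (((2,2),(0,2)), ((0,4),(1,1)));
   (((2,2),(1,0)), ((4,2),(2,0))); (((2,2),(2,1)), ((1,4),(2,4)))]%N.

Definition SL23_image (x : quad) : quad :=
  (nth (quad1, quad1) SL23_table (index x (unzip1 SL23_table))).2.

Lemma SL23_image_mul x y : x \in unzip1 SL23_table -> y \in unzip1 SL23_table ->
  SL23_image (quad_mul 3 x y) = quad_mul 5 (SL23_image x) (SL23_image y).
Proof.
have : all (fun x => all (fun y => SL23_image (quad_mul 3 x y) ==
    quad_mul 5 (SL23_image x) (SL23_image y)) (unzip1 SL23_table)) (unzip1 SL23_table).
  by vm_compute.
by move=> /allP h /h /allP h' /h' /eqP.
Qed.

Lemma SL23_image_det x : x \in unzip1 SL23_table -> quad_det 5 (SL23_image x) = 1%N.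
Proof.
have : all (fun x => quad_det 5 (SL23_image x) == 1%N) (unzip1 SL23_table).
  by vm_compute.
by move=> /allP h /h /eqP.
Qed.

Lemma SL23_table_det a b c d : (a < 3)%N -> (b < 3)%N -> (c < 3)%N -> (d < 3)%N ->
  quad_det 3 ((a, b), (c, d)) = 1%N -> ((a, b), (c, d)) \in unzip1 SL23_table.
Proof.
by case: a => [|[|[|//]]] _; case: b => [|[|[|//]]] _; case: c => [|[|[|//]]] _;
  case: d => [|[|[|//]]] _.
Qed.

(** Trivial kernel, stated by congruences because equalities between scalars of F give residues mod
    5. *)
Lemma SL23_image_inj x : x \in unzip1 SL23_table ->
  let: ((a, b), (c, d)) := SL23_image x in
  (a %% 5 = 1)%N -> (b %% 5 = 0)%N -> (c %% 5 = 0)%N -> (d %% 5 = 1)%N -> x = quad1.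
Proof.
have : all (fun x => let: ((a, b), (c, d)) := SL23_image x in
   [&& a %% 5 == 1, b %% 5 == 0, c %% 5 == 0 & d %% 5 == 1]%N ==> (x == quad1))
   (unzip1 SL23_table) by vm_compute.
move=> /allP h /h; case: (SL23_image x) => -[a b] [c d] /implyP h1 a1 b0 c0 d1.
by apply/eqP/h1; rewrite a1 b0 c0 d1.
Qed.

Lemma ord2_cases (P : 'I_2 -> Prop) : P ord0 -> P ord_max -> forall i, P i.
Proof.
move=> P0 P1 [[|[|//]] lt]; [move: P0 | move: P1]; congr P; exact: val_inj.
Qed.

Lemma det_mx2 (R : comNzRingType) (A : 'M[R]_2) :
  \det A = A ord0 ord0 * A ord_max ord_max - A ord0 ord_max * A ord_max ord0.
Proof.
rewrite (expand_det_row _ ord0) !big_ord_recl big_ord0 addr0 /cofactor !det_mx11 !mxE.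
have -> : lift ord0 ord0 = ord_max :> 'I_2 by apply: val_inj.
have -> : lift (ord_max : 'I_2) 0 = ord0 :> 'I_2 by apply: val_inj.
by rewrite expr0 expr1 mul1r mulN1r mulrN.
Qed.

(* Working over an abstract field K of order 3 with its residue map to nat avoids *)
(* the costly unification of the several structures on the concrete type 'F_3.    *)
Section ResidueQuadruple.

Variables (K : finFieldType) (res : K -> nat).
Hypotheses (res_lt : forall x, (res x < 3)%N) (res_inj : injective res).
Hypotheses (res0 : res 0 = 0%N) (res1 : res 1 = 1%N) (resN1 : res (-1) = 2%N).
Hypotheses (resD : forall x y, res (x + y) = ((res x + res y) %% 3)%N)
  (resM : forall x y, res (x * y) = ((res x * res y) %% 3)%N).

Definition mx_quad (A : 'M[K]_2) : quad :=
  ((res (A ord0 ord0), res (A ord0 ord_max)),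
   (res (A ord_max ord0), res (A ord_max ord_max))).

Lemma mx_quad_mul (A B : 'M[K]_2) : mx_quad (A *m B) = quad_mul 3 (mx_quad A) (mx_quad B).
Proof.
have E i j : res ((A *m B) i j) =
    ((res (A i ord0) * res (B ord0 j) + res (A i ord_max) * res (B ord_max j)) %% 3)%N.
  rewrite mxE !big_ord_recl big_ord0 addr0.
  have -> : lift ord0 ord0 = ord_max :> 'I_2 by apply: val_inj.
  by rewrite resD !resM modnDm.
by rewrite /mx_quad !E.
Qed.

Lemma mx_quad_det (A : 'M[K]_2) : \det A = 1 -> mx_quad A \in unzip1 SL23_table.
Proof.
move=> detA; apply: SL23_table_det => //.
have := congr1 res detA.
by rewrite det_mx2 -mulN1r resD !resM resN1 res1 modnMmr modnDm.
Qed.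

Lemma mx_quad1 (A : 'M[K]_2) : mx_quad A = quad1 -> A = 1%:M.
Proof.
case=> a b c d; apply/matrixP.
by apply: ord2_cases; apply: ord2_cases; rewrite mxE; apply: res_inj;
  rewrite ?a ?b ?c ?d /= ?mulr1n ?mulr0n ?res0 ?res1.
Qed.

End ResidueQuadruple.

(** Multiplication by diag(1, -1) exchanges determinants 1 and -1, so SL is half of GL, which has
    order 48. *)
Lemma card_SL23 : #|SL 2 'F_3| = 24%N.
Proof.
pose D : 'M['F_3]_2 := diag_mx (\row_j (-1) ^+ j).
have detD : \det D = -1.
  by rewrite det_diag !big_ord_recl big_ord0 !mxE mulr1 expr0 mul1r expr1.
have uD : D \in unitmx by rewrite unitmxE detD unitrN unitr1.
pose d : {'GL_2['F_3]} := Sub D uD.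
have detd (A : {'GL_2['F_3]}) : \det (GLval (A * d)%g) = - \det (GLval A).
  by rewrite GL_ME det_mulmx detD mulrN1.
have : ~: SL 2 'F_3 = [set (A * d)%g | A in SL 2 'F_3].
  apply/setP => A; rewrite !inE; apply/idP/imsetP => [A1|[B]].
    exists (A * d^-1)%g; last by rewrite mulgKV.
    have := detd (A * d^-1)%g; rewrite mulgKV => e.
    rewrite inE -[\det _]opprK -e.
    have := GL_det A; move: A1.
    by case: (\det _) => [[|[|[|//]]] ?].
  by rewrite inE => /eqP B1 ->; rewrite detd B1.
move/(congr1 (fun X : {set {'GL_2['F_3]}} => #|X|)).
rewrite card_imset; last exact: mulIg.
have := cardsC (SL 2 'F_3); have := card_GL_2 'F_3; rewrite card_Fp // cardsT => -> + e.
by rewrite e addnn => /(canRL doubleK).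
Qed.

(* A perm valued version of g without an injectivity argument; the opaque sigma type *)
(* keeps unification from evaluating the injectivity test.                           *)
Lemma perm_of_fun_subproof (T : finType) (g : T -> T) :
  {s : {perm T} | injective g -> s =1 g}.
Proof.
have [inj_g|not_inj] := @injectiveP _ _ g; last by exists 1%g.
by exists (perm inj_g) => _ x; rewrite permE.
Qed.

Definition perm_of_fun (T : finType) (g : T -> T) : {perm T} :=
  sval (perm_of_fun_subproof g).

Lemma perm_of_funE (T : finType) (g : T -> T) : injective g -> perm_of_fun g =1 g.
Proof. exact: (svalP (perm_of_fun_subproof g)). Qed.

(** * Isometries obtained from the table *)

Section Embedding.

Variables (F : finFieldType) (V : vectType F) (f : {biscalar V}).
Hypotheses (dimV : \dim {:V} = 2%N) (f_alt : alternating f)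
  (f_nondeg : nondegenerate_form f).
Hypothesis F5 : 5 \in [pchar F].
Variables (K : finFieldType) (res : K -> nat).
Hypotheses (res_lt : forall x, (res x < 3)%N) (res_inj : injective res).
Hypotheses (res0 : res 0 = 0%N) (res1 : res 1 = 1%N) (resN1 : res (-1) = 2%N).
Hypotheses (resD : forall x y, res (x + y) = ((res x + res y) %% 3)%N)
  (resM : forall x y, res (x * y) = ((res x * res y) %% 3)%N).
Variables e1 e2 : V.
Hypothesis e12 : f e1 e2 = 1.

Notation VT := (finvect_type V).
Implicit Types (u v w : V) (s : {perm VT}) (x y : quad).

(* The row vector of coordinates of v in the basis e1, e2 is multiplied by x. *)
Definition quad_act x v : V := let: ((a, b), (c, d)) := x in
  (f v e2 * a%:R + f e1 v * c%:R) *: e1 + (f v e2 * b%:R + f e1 v * d%:R) *: e2.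

Lemma coordE v : v = f v e2 *: e1 + f e1 v *: e2.
Proof. by rewrite {1}(@plane_decomp _ _ _ dimV f_alt e1 e2 v) ?e12 ?oner_neq0 // !divr1. Qed.

(** In a symplectic basis the form is the determinant of the coordinates, so matrices of determinant
    1 act as isometries. *)
Lemma form_coordE u v : f u v = f u e2 * f e1 v - f e1 u * f v e2.
Proof.
by rewrite {1}(coordE u) linearDl !linearZl_LR /= (altC f_alt e2 v) mulrN.
Qed.

Lemma coord1 k l : f (k *: e1 + l *: e2) e2 = k.
Proof. by rewrite linearDl !linearZl_LR /= e12 f_alt mulr1 mulr0 addr0. Qed.

Lemma coord2 k l : f e1 (k *: e1 + l *: e2) = l.
Proof. by rewrite linearDr !linearZr_LR /= e12 f_alt mulr1 mulr0 add0r. Qed.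

(** Acting on row vectors applies the left factor first, as products of permutations do. *)
Lemma quad_act_mul x y v : quad_act (quad_mul 5 x y) v = quad_act y (quad_act x v).
Proof.
case: x y => -[a b] [c d] [[a' b'] [c' d']]; rewrite /quad_act /= coord1 coord2.
rewrite !(GRing.natr_mod_pchar F5) !natrD !natrM.
by congr (_ *: _ + _ *: _); ring.
Qed.

Lemma quad_act_iso x u v : quad_det 5 x = 1%N -> f (quad_act x u) (quad_act x v) = f u v.
Proof.
case: x => -[a b] [c d] /(congr1 (fun n => n%:R : F)).
rewrite /quad_det (GRing.natr_mod_pchar F5) /=.
have F4 : 4%:R = -1 :> F.
  by apply/eqP; rewrite -subr_eq0 opprK natr1 (pcharf0 F5).
rewrite natrD !natrM F4 => det1; rewrite form_coordE [RHS]form_coordE /quad_act !coord1 !coord2.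
transitivity ((a%:R * d%:R + -1 * (b%:R * c%:R)) * (f u e2 * f e1 v - f e1 u * f v e2)).
  by ring.
by rewrite det1 mul1r.
Qed.

Lemma quad_act_inj x : quad_det 5 x = 1%N -> injective (quad_act x).
Proof.
move=> x1 u v e; apply: (form_inj f_nondeg) => w.
by rewrite -(quad_act_iso u w x1) e quad_act_iso.
Qed.

Definition SL23_perm (A : {'GL_2[K]}) : {perm VT} :=
  perm_of_fun (quad_act (SL23_image (mx_quad res (GLval A))) : VT -> VT).

Lemma SL_quad (A : {'GL_2[K]}) : A \in SL 2 K ->
  mx_quad res (GLval A) \in unzip1 SL23_table.
Proof. by rewrite inE => /eqP; apply: mx_quad_det. Qed.

Lemma SL23_permE (A : {'GL_2[K]}) v : A \in SL 2 K ->
  app (SL23_perm A) v = quad_act (SL23_image (mx_quad res (GLval A))) v.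
Proof.
move=> /SL_quad AQ; have inj := quad_act_inj (SL23_image_det AQ).
by rewrite /app /SL23_perm (@perm_of_funE VT _ inj).
Qed.

Lemma SL23_perm_morph : {in SL 2 K &, {morph SL23_perm : A B / (A * B)%g}}.
Proof.
move=> A B AS BS; apply: eq_app => v.
rewrite [LHS](SL23_permE _ (groupM AS BS)) [RHS]appM [RHS](SL23_permE _ BS).
rewrite [in RHS](SL23_permE _ AS).
by rewrite GL_ME mx_quad_mul // (SL23_image_mul (SL_quad AS) (SL_quad BS)) quad_act_mul.
Qed.

Lemma SL23_perm_Sp (A : {'GL_2[K]}) : A \in SL 2 K -> SL23_perm A \in Sp f.
Proof.
move=> AS; apply/SpP; split=> [k u v|u v]; rewrite -!/(app _ _) !SL23_permE //; last first.
  by apply/quad_act_iso/SL23_image_det/SL_quad.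
case: (SL23_image _) => -[a b] [c d].
rewrite /quad_act linearDl linearDr linearZl_LR linearZr_LR /=.
rewrite scalerDr !scalerA addrACA -!scalerDl; congr (_ *: _ + _ *: _); ring.
Qed.

Lemma SL23_perm_ker (A : {'GL_2[K]}) : A \in SL 2 K -> SL23_perm A = 1%g -> A = 1%g.
Proof.
move=> AS A1; apply: val_inj; apply: (mx_quad1 res_inj res0 res1).
have := SL23_image_inj (SL_quad AS); have := SL23_permE e1 AS; have := SL23_permE e2 AS.
rewrite A1 !app1; case: (SL23_image _) => -[a b] [c d]; rewrite /quad_act => h2 h1; apply.
- have := congr1 (f^~ e2) h1; rewrite coord1 e12 f_alt mul1r mul0r addr0 => h.
  by apply: (@eqr_nat_mod _ _ _ 1 F5).
- have := congr1 (f e1) h1; rewrite coord2 e12 f_alt mul1r mul0r addr0 => h.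
  by apply: (@eqr_nat_mod _ _ _ 0 F5).
- have := congr1 (f^~ e2) h2; rewrite coord1 e12 f_alt mul1r mul0r add0r => h.
  by apply: (@eqr_nat_mod _ _ _ 0 F5).
- have := congr1 (f e1) h2; rewrite coord2 e12 f_alt mul1r mul0r add0r => h.
  by apply: (@eqr_nat_mod _ _ _ 1 F5).
Qed.

Lemma SL23_embeds :
  exists H : {group {perm VT}}, H \subset Sp f /\ H \isog SL 2 K.
Proof.
pose phi := Morphism SL23_perm_morph.
exists [group of (phi @* SL 2 K)%g]; split.
  apply/subsetP => _ /morphimP[A _ AS ->]; exact: SL23_perm_Sp.
rewrite isog_sym; apply/isogP; exists phi => //; apply/subsetP => A /morphpreP[AS].
by rewrite !inE => /eqP /(SL23_perm_ker AS) ->.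
Qed.

End Embedding.

Lemma exists_SL23 (F : finFieldType) (V : vectType F) (f : {biscalar V}) :
  \dim {:V} = 2%N -> alternating f -> nondegenerate_form f -> 5 \in [pchar F] ->
  exists H : {group {perm finvect_type V}}, H \subset Sp f /\ H \isog SL 2 'F_3.
Proof.
move=> dimV f_alt f_nondeg F5; have [e1 [e2 e12]] := plane_nontrivial dimV f_nondeg.
apply: (@SL23_embeds F V f dimV f_alt f_nondeg F5 'F_3 (@nat_of_ord _)) e12 => //.
exact: val_inj.
Qed.

Theorem theorem3p6 (p k q : nat) (F : finFieldType) (V : vectType F)
    (f : {biscalar V}) (p_prime : prime p) (p_odd : odd p) (k_gt0 : (0 < k)%N)
    (q_def : q = (p ^ k)%N) (q_mod4 : (q = 1 %[mod 4])%N) (cardF : #|F| = q)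
    (dimV : \dim {:V} = 2%N) (f_alt : alternating f)
    (f_nondeg : nondegenerate_form f) :
  (forall G : {group {perm finvect_type V}},
     G \subset Sp f -> solvable G -> q <> 5%N ->
     forall S : {set {set finvect_type V}},
       complete_symplectic_spread f 1 S -> ~ [transitive G, on S | 'P^*])
  /\
  (q = 5%N ->
     (exists H : {group {perm finvect_type V}},
        H \subset Sp f /\ H \isog SL 2 'F_3) /\
     (forall H : {group {perm finvect_type V}},
        H \subset Sp f -> H \isog SL 2 'F_3 ->
        #|H| = 24%N /\
        exists S : {set {set finvect_type V}},
          complete_symplectic_spread f 1 S /\ [transitive H, on S | 'P^*])).
Proof.
have pF : p \in [pchar F] by apply: (card_finPcharP (n := k)) => //; rewrite cardF.
have card_L := card_lines dimV f_alt f_nondeg.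
split=> [G GS solG q5 S spS trG | q5].
  rewrite (spread_lines dimV f_alt f_nondeg spS) in trG.
  have two0 : 2%:R != 0 :> F.
    rewrite -(dvdn_pcharf pF) dvdn_prime2 //; apply: contraL p_odd => /eqP->.
    by [].
  have F4 : (#|F| = 1 %[mod 4])%N by rewrite cardF.
  have [i ii] := finField_sqrtN1 F4.
  apply: (transitive_not_solvable dimV f_alt f_nondeg two0 ii GS trG _ _ solG).
    by rewrite card_L -modnDml F4.
  (* From q = 1 mod 4, q > 1 and q distinct from 5 follows q >= 9, so there are more than 9
     lines. *)
  have := finNzRing_gt1 F; rewrite card_L cardF; move: q_mod4 q5; clear; lia.
have F5 : 5 \in [pchar F] by apply: (card_finPcharP (n := 1)); rewrite // cardF q5.
split=> [|H HS isoH]; first exact: exists_SL23.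
have H24 : #|H| = 24%N by rewrite (card_isog isoH) card_SL23.
split=> //; exists (lines f); split; first exact: lines_spread.
have [v [v0 vL]] := lines_inhab dimV f_nondeg.
(* Stabilisers have order at most 4, so orbits have at least 24 / 4 = 6 elements, the number of
   lines. *)
have := stab_line_le dimV f_alt f_nondeg F5 HS _ v0; rewrite H24 cardF q5 => /(_ isT) st.
have orb := card_orbit_stab ('P^*) H (line f v); rewrite H24 in orb.
apply/imsetP; exists (line f v) => //; apply/esym/eqP; rewrite eqEcard.
rewrite (acts_sub_orbit _ (acts_lines HS)) vL card_L cardF q5 /=.
by move: st orb; set a := #|_|; set b := #|_|; clearbody a b; clear; nia.
Qed.
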